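(* Let $k$ be a field. There exist (for suitable numbers $t$ of variables) log-linear arrays $A$ whose associated weight ideals $I_A\subseteq k\langle x_1,\dots,x_t\rangle$ are trivial (i.e. $I_A=\{0\}$); there exist log-linear arrays whose associated weight ideals admit a finite generating set; and there exist log-linear arrays whose associated weight ideals do not admit a finite generating set. (Generating sets are as two-sided ideals; all log-linear arrays considered are nondegenerate and have slope $d\neq 1$.)
   Context: Let $R=k\langle x_1,\dots,x_t\rangle$ be the free associative algebra, $\mathcal{B}^{\times}$ the set of nonempty words in $x_1,\dots,x_t$, and $|\omega|$ the length of a word $\omega$. $\mathcal{M}_{t\times\infty}(\mathbb{R}_{>0})$ denotes the set of $t\times\infty$ arrays $A=(a_{i,j})$, $1\le i\le t$, $j\ge 0$ (columns are indexed starting from $0$), with positive real entries. The weight function of $A$ is $\sigma(x_{u_0}x_{u_1}\cdots x_{u_{l-1}})=\prod_{j=0}^{l-1}a_{u_j,j}$. The weight ideal $I_A$ is the two-sided ideal of $R$ generated by all differences $\omega_1-\omega_2$ with $\omega_1,\omega_2\in\mathcal{B}^{\times}$, $|\omega_1|=|\omega_2|$ and $\sigma(\omega_1)=\sigma(\omega_2)$. $A$ is nondegenerate if $\sigma(x_i)\ne\sigma(x_j)$ for all $i\neq j$. An array is linear with slope $d>0$ if for every $i\ge 1$ its $i$-th column is $d$ times its $(i-1)$-st column. An array $A$ is log-linear if $\log A=(\log a_{i,j})$ is a linear array (in $\mathcal{M}_{t\times\infty}(\mathbb{R}_{>0})$); its slope is the slope of $\log A$. Thus a log-linear array has entries $e^{d^j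 a_i}$ for some $a_1,\dots,a_t>0$ and $d>0$. *)

(* Defs.v *)
From HB Require Import structures.
From mathcomp Require Import all_boot all_order all_algebra.
From mathcomp Require Import boolp classical_sets reals exp.
From mathcomp Require Import monalg.

Set Implicit Arguments.
Unset Strict Implicit.
Unset Printing Implicit Defensive.

Import Order.TTheory GRing.Theory Num.Theory.

Local Open Scope classical_set_scope.
Local Open Scope ring_scope.

(* [{fmonom I}] is the free monoid on [I] (words under concatenation), so its
   monoid algebra over [k] is the free associative algebra. *)
Notation free_algebra k t := {malg k[{fmonom 'I_t}]}.

Section Ideals.
Variable S : pzRingType.

Definition two_sided_ideal (I : set S) : Prop :=
  [/\ I 0,
      forall x y, I x -> I y -> I (x - y) &
      forall a x b, I x -> I (a * x * b)].

Definition ideal_generated (G : set S) : set S := smallest two_sided_ideal G.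

Definition finitely_generated_ideal (I : set S) : Prop :=
  exists s : seq S, I = ideal_generated [set` s].

End Ideals.

Section Arrays.
Variables (R : realType) (t : nat).

(* Rows are indexed by ['I_t], columns by [nat] starting from 0. *)
Definition array := 'I_t -> nat -> R.
Implicit Type A : array.

Definition positive_array A : Prop := forall i j, 0 < A i j.

Definition log_array A : array := fun i j => ln (A i j).

Definition linear_array (d : R) A : Prop :=
  [/\ positive_array A, 0 < d & forall i j, A i j.+1 = d * A i j].

(* [log A] must itself have positive entries: the entries of [A] exceed 1. *)
Definition log_linear (d : R) A : Prop :=
  positive_array A /\ linear_array d (log_array A).

Definition weight A (w : {fmonom 'I_t}) : R :=
  \prod_(j < size w) A (tnth (in_tuple w) j) j.

Definition nondegenerate A : Prop :=
  forall i j : 'I_t, i != j -> weight A (fmu i) != weight A (fmu j).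

Definition weight_relations (k : fieldType) A : set (free_algebra k t) :=
  [set r | exists w1 w2 : {fmonom 'I_t},
     [/\ (0 < size w1)%N, (0 < size w2)%N, size w1 = size w2,
         weight A w1 = weight A w2 & r = << w1 >> - << w2 >>]].

Arguments weight_relations k A _ : clear implicits.

Definition weight_ideal (k : fieldType) A : set (free_algebra k t) :=
  ideal_generated (weight_relations k A).

Definition admissible (d : R) A : Prop :=
  [/\ log_linear d A, nondegenerate A & d != 1].

End Arrays.

Arguments weight_relations {R t} k A _.
Arguments weight_ideal {R t} k A _.

(* Main.v *)
(** Take [A i j = exp (c i * d ^ j)] with natural numbers [d] and [c i].  The
    weight of a word is then determined by the number whose base [d] expansion,
    least significant digit first, has the letters' values [c i] as digits, so
    that weight relations are coincidences between such expansions.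

    - Base 2, digits 1, 2: the digits are distinct modulo the base, hence
      expansions are unique and the ideal is zero.
    - Base 2, digits 1, 2, 3: propagating a carry from left to right rewrites
      one of two words of equal weight into the other by means of
      (3,1) ~ (1,2) and (3,2) ~ (1,3), which therefore generate the ideal.
    - Base 3, digits 2, 3, 4, 6: for every [m], the words (6,4,...,4,2) and
      (3,2,...,2,3) with [m] inner letters have the same weight, a carry of 1
      being forwarded at every position, whereas every proper factor of the
      first one is alone in its weight class.  Elements of the ideal have
      coefficient zero at these factors, so a finite set of generators, being
      of bounded degree, lies for [m] large in the ideal of elements whose
      coefficients at all factors of (6,4,...,4,2) vanish, unlike the
      difference of the two words. *)

Require Import Defs.
From HB Require Import structures.
From mathcomp Require Import all_boot all_order all_algebra.
From mathcomp Require Import boolp classical_sets reals sequences exp.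
From mathcomp Require Import finmap monalg zify.

Set Implicit Arguments.
Unset Strict Implicit.
Unset Printing Implicit Defensive.

Import Order.TTheory GRing.Theory Num.Theory.

Local Open Scope classical_set_scope.
Local Open Scope ring_scope.

(** * Two-sided ideals *)

Section Ideals.
Variable S : pzRingType.
Implicit Types (G I : set S).

Lemma ideal_generated_ideal G : two_sided_ideal (ideal_generated G).
Proof.
split=> [J [[J0 _ _] _] //|x y Gx Gy J GJ|a x b Gx J GJ].
  by have [[_ JB _] _] := GJ; apply: JB; [exact: Gx|exact: Gy].
by have [[_ _ JM] _] := GJ; apply: JM; exact: Gx.
Qed.

Lemma ideal_generated_sub G I :
  two_sided_ideal I -> G `<=` I -> ideal_generated G `<=` I.
Proof. exact: smallest_sub. Qed.

Lemma mem_ideal_generated G : G `<=` ideal_generated G.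
Proof. exact: sub_gen_smallest. Qed.

Lemma ideal_opp I x : two_sided_ideal I -> I x -> I (- x).
Proof. by case=> I0 IB _ Ix; rewrite -(sub0r x); exact: IB. Qed.

Lemma ideal_add I x y : two_sided_ideal I -> I x -> I y -> I (x + y).
Proof.
move=> idI Ix Iy; rewrite -(opprK y); case: (idI) => _ IB _.
by apply: IB => //; exact: ideal_opp.
Qed.

End Ideals.

(** * Coefficients in a monoid algebra *)

Section MonoidAlgebra.
Variables (K : monomType) (k : nzRingType).

(** A contribution to the coefficient of [a * x * b] at [w] comes from a factorization of [w] whose
    middle factor is a monomial of [x]; by hypothesis that factor lies in [V]. *)
Lemma vanishing_ideal (V : set K) :
    (forall a v b, V (mmul (mmul a v) b) -> V v) ->
  two_sided_ideal [set x : {malg k[K]} | forall w, V w -> x@_w = 0].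
Proof.
move=> factV; split=> [w _|x y x0 y0 w Vw|a x b x0 w Vw] /=.
- by rewrite mcoeff0.
- by rewrite mcoeffB x0 // y0 // subr0.
rewrite mcoeffMl big1_seq // => u _; rewrite big1_seq // => v _.
case: eqP => [uv|_]; last by rewrite mulr0n.
rewrite mcoeffMl !big1_seq ?mul0r ?mul0rn // => u1 _.
rewrite big1_seq // => u2 _; case: eqP => [u12|_]; last by rewrite mulr0n.
by rewrite x0 ?mulr0 ?mul0rn //; apply: (factV u1 _ v); rewrite u12 uv.
Qed.

Lemma mcoeff_bounded_support (mdeg : K -> nat) (s : seq {malg k[K]}) :
  exists n, forall x, x \in s -> forall w, (n < mdeg w)%N -> x@_w = 0.
Proof.
exists (\max_(x <- s) \max_(w <- msupp x) mdeg w)%N => x xs w.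
apply: contraTeq; rewrite mcoeff_neq0 -leqNgt => xw.
apply: leq_trans (leq_bigmax_seq (P := xpredT) _ xs isT).
exact: (leq_bigmax_seq (P := xpredT) _ xw isT).
Qed.

End MonoidAlgebra.

(** * Congruence of words modulo an ideal *)

Section Words.
Variables (I : choiceType) (k : nzRingType) (J : set {malg k[{fmonom I}]}).
Hypothesis idJ : two_sided_ideal J.

(* A [Variant] rather than a definition, which unification would unfold down to
   the representation of [malg] whenever two words fail to match. *)
Variant word_congr (u v : seq I) : Prop :=
  WordCongr of J (<< FMonom u >> - << FMonom v >>).

Lemma word_congr_refl u : word_congr u u.
Proof. by split; rewrite subrr; case: idJ. Qed.

Lemma word_congr_sym u v : word_congr u v -> word_congr v u.
Proof. by case=> /(ideal_opp idJ) vu; split; rewrite -opprB. Qed.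

Lemma word_congr_trans v u w :
  word_congr u v -> word_congr v w -> word_congr u w.
Proof.
by case=> uv [/(ideal_add idJ uv) uw]; split; rewrite addrA subrK in uw.
Qed.

Lemma FMonom_cat (u v : seq I) : FMonom (u ++ v) = mmul (FMonom u) (FMonom v).
Proof. by apply/eqP; rewrite fmP fmM. Qed.

Lemma malgU_cat (u v : seq I) :
  << FMonom (u ++ v) >> = << FMonom u >> * << FMonom v >> :> {malg k[{fmonom I}]}.
Proof. by rewrite malgM_def fgmulUU mulr1 FMonom_cat. Qed.

Lemma word_congr_cat x y u v :
  word_congr u v -> word_congr (x ++ u ++ y) (x ++ v ++ y).
Proof.
case: idJ => _ _ JM [/(JM << FMonom x >> _ << FMonom y >>) xuvy]; split.
by rewrite !malgU_cat !mulrA -mulrBl -mulrBr.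
Qed.

Lemma word_congr_cons i u v : word_congr u v -> word_congr (i :: u) (i :: v).
Proof. by move/(word_congr_cat [:: i] [::]); rewrite !cats0. Qed.

Lemma word_congr_catr u v y : word_congr u v -> word_congr (u ++ y) (v ++ y).
Proof. exact: (word_congr_cat [::]). Qed.

End Words.

(** * Expansions in base [d] and exponential arrays *)

Section Expansions.
Variables (t : nat) (c : 'I_t -> nat) (d : nat).

Definition expansion (w : seq 'I_t) : nat :=
  foldr (fun i n => c i + d * n)%N 0%N w.

Lemma expansion_cons i w : expansion (i :: w) = (c i + d * expansion w)%N.
Proof. by []. Qed.

Lemma expansion_cat u v :
  expansion (u ++ v) = (expansion u + d ^ size u * expansion v)%N.
Proof.
elim: u => [|i u IHu] /=; first by rewrite expn0 mul1n.
by rewrite IHu mulnDr addnA mulnA expnS.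
Qed.

Definition isolated (w : seq 'I_t) : Prop :=
  forall v, size v = size w -> expansion v = expansion w -> v = w.

Lemma isolated_factor x w y : isolated (x ++ w ++ y) -> isolated w.
Proof.
move=> iso v sz_v exp_v; have: x ++ v ++ y = x ++ w ++ y.
  by apply: iso; rewrite ?size_cat ?sz_v // !expansion_cat exp_v sz_v.
by move/eqP; rewrite eqseq_cat // eqxx eqseq_cat //= => /andP[/eqP].
Qed.

(** The expansion modulo [d] determines the first letter; cancel it and induct. *)
Lemma isolated_all :
    (0 < d)%N -> (forall i j, c i = c j %[mod d] -> i = j) ->
  forall w, isolated w.
Proof.
move=> d0 c_inj; elim=> [[]//|i w IHw [//|j v] /= [sz_v] exp_v].
have eq_ij : j = i.
  apply: c_inj.
  rewrite -(modnMDl (expansion v) (c j)) -(modnMDl (expansion w) (c i)).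
  by rewrite !(mulnC _ d) !(addnC (d * _)%N) exp_v.
rewrite eq_ij in exp_v *; congr (_ :: _); apply: IHw => //.
by move/addnI/eqP: exp_v; rewrite eqn_pmul2l // => /eqP.
Qed.

Variable R : realType.

Definition exp_array : array R t := fun i j => expR (c i * d ^ j)%:R.

Lemma weight_exp_array w : weight exp_array w = expR (expansion w)%:R.
Proof.
rewrite /weight /exp_array; case: w => w /=.
(* The tail of a word starts one column later, so the induction needs an arbitrary starting column
   [m]. *)
suff H m : \prod_(j < size w) expR (c (tnth (in_tuple w) j) * d ^ (m + j))%:R =
    expR (d ^ m * expansion w)%:R :> R.
  by have := H 0%N; rewrite expn0 mul1n.
elim: w m => [|i w IHw] m /=; first by rewrite big_ord0 muln0 expR0.
rewrite big_ord_recl (tnth_nth i) /= addn0.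
transitivity (expR (c i * d ^ m)%:R * expR (d ^ m.+1 * expansion w)%:R : R).
  rewrite -(IHw m.+1); congr (_ * _); apply: eq_bigr => j _.
  by rewrite !(tnth_nth i) /= addSnnS.
by rewrite -expRD -natrD expnS; congr (expR _%:R); lia.
Qed.

Lemma weight_exp_array_eq u v :
  (weight exp_array u = weight exp_array v) <-> (expansion u = expansion v).
Proof.
rewrite !weight_exp_array; split=> [/expR_inj/eqP|->//].
by rewrite eqr_nat => /eqP.
Qed.

Lemma admissible_exp_array :
    (1 < d)%N -> (forall i, 0 < c i)%N -> injective c ->
  admissible d%:R exp_array.
Proof.
move=> d1 c0 c_inj; have d0 : (0 < d)%N by lia.
split; last by rewrite pnatr_eq1; lia.
  split; first by move=> i j; exact: expR_gt0.
  split=> [i j||i j]; rewrite /log_array /exp_array ?expRK ?ltr0n //.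
    by rewrite muln_gt0 c0 expn_gt0 d0.
  by rewrite -natrM expnS mulnCA.
move=> i j; apply: contra_neq => /weight_exp_array_eq.
by rewrite !fmU /= !muln0 !addn0 => /c_inj.
Qed.

Variable k : fieldType.

Lemma weight_ideal_expansion u v :
    size u = size v -> expansion u = expansion v ->
  weight_ideal k exp_array (<< FMonom u >> - << FMonom v >>).
Proof.
case: u v => [|i u] [|j v] // sz_uv exp_uv.
  by rewrite subrr; case: (ideal_generated_ideal (weight_relations k exp_array)).
apply: mem_ideal_generated; exists (FMonom (i :: u)), (FMonom (j :: v)).
by split=> //; exact/weight_exp_array_eq.
Qed.

(** Factors of isolated words are isolated, so [vanishing_ideal] reduces the claim to the
    generators. *)
Lemma mcoeff_isolated x w :
  weight_ideal k exp_array x -> isolated w -> x@_(FMonom w) = 0.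
Proof.
move=> + iso_w; move: x.
suff sub : weight_ideal k exp_array `<=`
    [set x | forall w : {fmonom 'I_t}, isolated w -> x@_w = 0].
  by move=> x /sub; apply.
apply: ideal_generated_sub.
  apply: (@vanishing_ideal _ _ [set w : {fmonom 'I_t} | isolated w]) => a v b /=.
  by rewrite !fmM -catA; exact: isolated_factor.
move=> _ [w1 [w2 [_ _ sz /weight_exp_array_eq exp12 ->]]] v iso_v /=.
rewrite mcoeffB !mcoeffU1.
(* If one of the two words is the isolated [v], so is the other, and the terms cancel. *)
have -> : (w1 == v) = (w2 == v); last by rewrite subrr.
rewrite !fmP; by apply/eqP/eqP => e; rewrite -e in iso_v *; apply: iso_v.
Qed.

Lemma weight_ideal0 : (forall w, isolated w) -> weight_ideal k exp_array = [set 0].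
Proof.
move=> iso; apply/seteqP; split=> [x Ix|_ ->] /=.
  by apply/malgP => w; rewrite mcoeff0 -(fmK w); apply: mcoeff_isolated.
by case: (ideal_generated_ideal (weight_relations k exp_array)).
Qed.

Lemma weight_ideal_infinitely_generated :
    (forall n, exists i j u v,
      [/\ (n < size (rcons (i :: u) j))%N, size v = size (rcons (i :: u) j),
          expansion v = expansion (rcons (i :: u) j), v <> rcons (i :: u) j
        & isolated (i :: u) /\ isolated (rcons u j)]) ->
  ~ finitely_generated_ideal (weight_ideal k exp_array).
Proof.
move=> long [s Is]; have [n bound_n] := mcoeff_bounded_support (@fdeg 'I_t) s.
have [i [j [u [v [lt_n sz_v exp_v neq_v [iso_iu iso_uj]]]]]] := long n.
pose w := rcons (i :: u) j; pose V : set {fmonom 'I_t} :=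
  [set f | exists x y, w = x ++ f ++ y].
have idV : two_sided_ideal [set x : {malg k[_]} | forall f, V f -> x@_f = 0].
  apply: vanishing_ideal => a f b [x [y wE]].
  by exists (x ++ a), (b ++ y); rewrite wE !fmM -!catA.
have IV : weight_ideal k exp_array `<=` [set x | forall f, V f -> x@_f = 0].
  rewrite Is; apply: ideal_generated_sub => // g /= gs f [x [y wE]].
  have Ig : weight_ideal k exp_array g by rewrite Is; exact: mem_ideal_generated.
  have [/bound_n->//|size_f] := ltnP n (size f).
  rewrite -(fmK f); apply: (mcoeff_isolated Ig).
  (* A factor of length at most [n] is proper, so it misses the first or the last letter of [w]. *)
  case: x wE => [|i' x] /=; last first.
    by case=> _ ujE; move: iso_uj; rewrite ujE; exact: isolated_factor.
  case/lastP: y => [|y j']; rewrite ?cats0.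
    by move=> wE; rewrite -/w wE ltnNge size_f in lt_n.
  rewrite -rcons_cat /w => /rcons_inj[iuE _]; move: iso_iu; rewrite iuE.
  exact: (@isolated_factor [::]).
have := IV _ (weight_ideal_expansion (esym sz_v) (esym exp_v)) (FMonom w).
rewrite mcoeffB !mcoeffU1 eqxx => /(_ _)/eqP; rewrite /= !fmP /=.
rewrite (negbTE (introN eqP neq_v)) subr0 oner_eq0; case/(_ _)/Bool.diff_false_true.
by exists [::], [::]; rewrite cats0.
Qed.

End Expansions.

(** * Finite generation in base 2 *)

Section FiniteExample.

Local Notation digit i := (@Ordinal 3 i isT).

Local Notation c := (fun i : 'I_3 => i.+1).
Local Notation E := (expansion c 2).

Let ord3P (i : 'I_3) : [\/ i = digit 0, i = digit 1 | i = digit 2].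
Proof.
by case: i => [[|[|[|//]]] lti];
  [constructor 1|constructor 2|constructor 3]; exact: val_inj.
Qed.

Section Carry.
Variables (k : nzRingType) (J : set {malg k[{fmonom 'I_3}]}).
Hypothesis idJ : two_sided_ideal J.
Hypothesis J20 : word_congr J [:: digit 2; digit 0] [:: digit 0; digit 1].
Hypothesis J21 : word_congr J [:: digit 2; digit 1] [:: digit 0; digit 2].

(** Here [digit i] has value i + 1. Distinct first letters of equal parity are 3 and 1, whose
    difference is a carry of 1 into the tails. Hence equality at length n + 1 uses the carry claim
    at n, and in turn serves the carry claim at n + 1. *)
Lemma carry_congr n :
  (forall u v, size u = n -> size v = n -> E u = E v -> word_congr J u v) /\
  (forall u v, size u = n -> size v = n -> E v = (E u).+1 ->
     word_congr J (digit 2 :: u) (digit 0 :: v)).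
Proof.
elim: n => [|n [IHeq IHcarry]].
  by split=> -[|//] [|//] // *; exact: (word_congr_refl idJ).
have congr_eq u v :
    size u = n.+1 -> size v = n.+1 -> E u = E v -> word_congr J u v.
  case: u v => [//|i u] [//|j v] [su] [sv]; rewrite !expansion_cons => Euv.
  have [eq_ij|neq_ij] := eqVneq i j.
    rewrite eq_ij in Euv *.
    by apply: (word_congr_cons idJ); apply: IHeq => //; lia.
  case: (ord3P i) (ord3P j) neq_ij Euv => -> [] -> //= _ Euv.
  - lia.
  - by apply: (word_congr_sym idJ); apply: IHcarry => //; lia.
  - lia.
  - lia.
  - by apply: IHcarry => //; lia.
  - lia.
have J20_cat y : word_congr J [:: digit 2, digit 0 & y] [:: digit 0, digit 1 & y].
  exact: (word_congr_catr idJ y J20).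
have J21_cat y : word_congr J [:: digit 2, digit 1 & y] [:: digit 0, digit 2 & y].
  exact: (word_congr_catr idJ y J21).
split=> // u v; case: u => [//|i u] su sv Euv.
case: (ord3P i) su Euv => -> su Euv.
- apply: (word_congr_trans idJ (J20_cat u)); apply: (word_congr_cons idJ).
  by apply: congr_eq => //; rewrite Euv !expansion_cons /=; lia.
- apply: (word_congr_trans idJ (J21_cat u)); apply: (word_congr_cons idJ).
  by apply: congr_eq => //; rewrite Euv !expansion_cons /=; lia.
(* By parity the second word starts with 2, and the carry moves on: (3,3,u) ~ (3,1,v) ~ (1,2,v). *)
case: v sv Euv => [//|j v] [sv]; case: su => su; rewrite !expansion_cons /=.
case: (ord3P j) => -> /= Euv.
- lia.
- apply: (word_congr_trans idJ _ (J20_cat v)).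
  by apply: (word_congr_cons idJ); apply: IHcarry => //; lia.
- lia.
Qed.

End Carry.

Lemma finitely_generated_weight_ideal (R : realType) (k : fieldType) :
  finitely_generated_ideal (weight_ideal k (exp_array c 2 R)).
Proof.
pose g20 : free_algebra k 3 :=
  << FMonom [:: digit 2; digit 0] >> - << FMonom [:: digit 0; digit 1] >>.
pose g21 : free_algebra k 3 :=
  << FMonom [:: digit 2; digit 1] >> - << FMonom [:: digit 0; digit 2] >>.
exists [:: g20; g21]; apply/seteqP; split; apply: ideal_generated_sub.
- exact: ideal_generated_ideal.
- move=> _ [u [v [_ _ suv /weight_exp_array_eq Euv ->]]].
  have J20 : ideal_generated [set` [:: g20; g21]] g20.
    by apply: mem_ideal_generated; rewrite /= mem_head.
  have J21 : ideal_generated [set` [:: g20; g21]] g21.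
    by apply: mem_ideal_generated; rewrite /= mem_behead // mem_head.
  have [/(_ u v erefl (esym suv) Euv)[]] := carry_congr
    (ideal_generated_ideal _) (WordCongr J20) (WordCongr J21) (size u).
  by rewrite !fmK.
- exact: ideal_generated_ideal.
by move=> x /=; rewrite !inE => /orP[]/eqP->; exact: weight_ideal_expansion.
Qed.

End FiniteExample.

(** * Infinite generation in base 3 *)

Section InfiniteExample.

Local Notation digit i := (@Ordinal 4 i isT).

Definition digits2346 (i : 'I_4) : nat := nth 0%N [:: 2; 3; 4; 6]%N i.
Local Notation c := digits2346.
Let cE :
  (c (digit 0) = 2%N) * (c (digit 1) = 3%N) *
  (c (digit 2) = 4%N) * (c (digit 3) = 6%N).
Proof. by []. Qed.

Let ord4P (i : 'I_4) :
  [\/ i = digit 0, i = digit 1, i = digit 2 | i = digit 3].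
Proof.
by case: i => [[|[|[|[|//]]]] lti];
  [constructor 1|constructor 2|constructor 3|constructor 4]; exact: val_inj.
Qed.

(** Only 3 and 6 are congruent modulo 3, so the letters 4 and 2 are forced. *)
Lemma isolated_suffix m : isolated c 3 (rcons (nseq m (digit 2)) (digit 0)).
Proof.
elim: m => [|m IHm] [//|j v]; rewrite size_rcons size_nseq => /succn_inj sv.
  by case: v sv => // _; case: (ord4P j) => ->.
rewrite [nseq _ _]/= rcons_cons !expansion_cons.
case: (ord4P j) => ->; rewrite !cE => Ev; [lia|lia| |lia].
by congr (_ :: _); apply: IHm; [rewrite size_rcons size_nseq|lia].
Qed.

(** Since 4 + 1 = 2 + 3, a carry into 4 forces the letter 2 and a new carry, which has nowhere to go
    at the end of the word. *)
Lemma expansion_nseq_carry m v :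
  size v = m -> expansion c 3 v <> (expansion c 3 (nseq m (digit 2))).+1.
Proof.
elim: m v => [|m IHm] [|j v] // /succn_inj /IHm IHv.
by rewrite [nseq _ _]/= !expansion_cons; case: (ord4P j) => ->; rewrite !cE; lia.
Qed.

Lemma isolated_prefix m : isolated c 3 (digit 3 :: nseq m (digit 2)).
Proof.
move=> [//|j v] sz; have sv : size v = m by case: sz; rewrite size_nseq.
have := expansion_nseq_carry sv; rewrite !expansion_cons.
(* A first letter 3 instead of 6 would carry 1 into the tail, contrary to [Nv]. *)
case: (ord4P j) => ->; rewrite !cE => Nv Ev; [lia|lia|lia|congr (_ :: _)].
have := @isolated_suffix m; rewrite -cats1.
move/(@isolated_factor _ _ _ [::]); apply; rewrite ?size_nseq //.
lia.
Qed.

Lemma infinitely_generated_weight_ideal (R : realType) (k : fieldType) :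
  ~ finitely_generated_ideal (weight_ideal k (exp_array c 3 R)).
Proof.
apply: weight_ideal_infinitely_generated => m.
exists (digit 3), (digit 0), (nseq m (digit 2)).
exists (digit 1 :: rcons (nseq m (digit 0)) (digit 1)).
split=> //; first by rewrite !size_rcons /= size_nseq.
  by rewrite !size_rcons /= !size_rcons !size_nseq.
  rewrite rcons_cons !expansion_cons.
  suff -> : expansion c 3 (rcons (nseq m (digit 0)) (digit 1)) =
    (expansion c 3 (rcons (nseq m (digit 2)) (digit 0))).+1 by rewrite !cE; lia.
  elim: m => [|m IHm] //.
  rewrite -![nseq m.+1 _]/(_ :: nseq m _) !rcons_cons !expansion_cons IHm !cE.
  lia.
by split; [exact: isolated_prefix|exact: isolated_suffix].
Qed.

End InfiniteExample.

Theorem theorem26 (R : realType) (k : fieldType) :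
  [/\ exists (t : nat) (d : R) (A : array R t),
        [/\ (0 < t)%N, admissible d A & weight_ideal k A = [set 0]],
      exists (t : nat) (d : R) (A : array R t),
        [/\ (0 < t)%N, admissible d A &
            finitely_generated_ideal (weight_ideal k A)]
    & exists (t : nat) (d : R) (A : array R t),
        [/\ (0 < t)%N, admissible d A &
            ~ finitely_generated_ideal (weight_ideal k A)]].
Proof.
split.
- exists 2, 2%:R, (exp_array (fun i : 'I_2 => i.+1) 2 R); split=> //.
    by apply: admissible_exp_array => // i j [/val_inj].
  apply: weight_ideal0; apply: isolated_all => //.
  by case=> [[|[|//]] ?] [[|[|//]] ?] //= _; exact: val_inj.
- exists 3, 2%:R, (exp_array (fun i : 'I_3 => i.+1) 2 R); split=> //.
    by apply: admissible_exp_array => // i j [/val_inj].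
  exact: finitely_generated_weight_ideal.
exists 4, 3%:R, (exp_array digits2346 3 R).
split=> //; last exact: infinitely_generated_weight_ideal.
apply: admissible_exp_array => //; first by case=> [[|[|[|[|//]]]] ?].
by case=> [[|[|[|[|//]]]] ?] [[|[|[|[|//]]]] ?] //= _; exact: val_inj.
Qed.
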